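(* Let $V$ be an $m$-dimensional complex vector space, with a fixed basis identifying $\mathrm{End}(V)$ with the algebra of $m\times m$ complex matrices. Then every symmetric matrix $Q \in \mathrm{End}(V)$ (that is, $Q^T = Q$) is of the form $Q = P^T P$ for some $P \in \mathrm{End}(V)$.
   Context: $P^T$ denotes the ordinary transpose (not the conjugate transpose) of the complex matrix $P$. *)

(* Defs.v *)
From mathcomp Require Import all_boot all_order all_algebra.
From mathcomp Require Import reals complex.

Set Implicit Arguments.
Unset Strict Implicit.
Unset Printing Implicit Defensive.

Import GRing.Theory.

Local Open Scope ring_scope.

(* [passmx.mxof e e f] acts on row vectors, so it is the transpose of the usual
   (column) matrix of f in the basis e; as both [mxof] and [hommx] follow this
   convention, f^T below does not depend on it. *)
Definition trEnd (F : fieldType) (V : vectType F)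
    (e : (\dim {:V}).-tuple V) (f : 'End(V)) : 'End(V) :=
  passmx.hommx e e (passmx.mxof e e f)^T.

(* Main.v *)
Require Import Defs.
From mathcomp Require Import all_boot all_order all_algebra.
From mathcomp Require Import reals complex.

(** A complex symmetric bilinear form is a sum of squares of linear forms.
    In matrix terms, as long as the symmetric matrix [A] is nonzero, polarization
    gives a row vector [v] with [c := v A v^T] nonzero; with [s ^+ 2 = c] and
    [u := s^-1 (v A)], subtracting the square [u^T u] leaves a symmetric matrix
    whose kernel contains that of [A] and, in addition, [v].  Each step thus lowers
    the rank, so [A] is the sum of [k] squares [u_i^T u_i] as soon as
    [\rank A <= k] (lemma [sym_mx_factor]), that is, [A = B B^T] where the columns
    of [B] are the [u_i^T].  Since the rank is at most the dimension, [B] can be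
    taken square, hence read as an endomorphism.  Peeling off squares in this way,
    rather than completing [v] to an orthogonal basis, avoids any change of
    basis. *)

Import GRing.Theory.

Local Open Scope ring_scope.

(** Polarization: if [A i i] and [A j j] vanish, then the form takes the value
    [2 A i j] at the sum of the [i]-th and [j]-th basis vectors. *)
Lemma sym_mx_anisotropic_vector (F : fieldType) (n : nat) (A : 'M[F]_n) :
    (2%:R : F) != 0 -> A^T = A -> A != 0 ->
  exists v : 'rV_n, (v *m A *m v^T) 0 0 != 0.
Proof.
move=> nz2 symA nzA.
have entryE (k l : 'I_n) :
    ((delta_mx 0 k : 'rV_n) *m A *m (delta_mx 0 l : 'rV_n)^T) 0 0 = A k l.
  by rewrite -rowE trmx_delta -colE !mxE.
have /existsP[i /existsP[j nzAij]] : [exists i, exists j, A i j != 0].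
  apply: contraR nzA; rewrite negb_exists => /forallP A0.
  apply/eqP/matrixP=> i j; rewrite mxE; apply/eqP.
  by have := A0 i; rewrite negb_exists => /forallP/(_ j); rewrite negbK.
have [Aii|] := eqVneq (A i i) 0; last by exists (delta_mx 0 i); rewrite entryE.
have [Ajj|] := eqVneq (A j j) 0; last by exists (delta_mx 0 j); rewrite entryE.
have Aji : A j i = A i j by rewrite -{1}symA mxE.
exists (delta_mx 0 i + delta_mx 0 j).
rewrite linearD /= mulmxDl !mulmxDr !mulmxDl.
rewrite mxE [X in X + _]mxE [X in _ + X]mxE !entryE.
by rewrite Aii Ajj Aji add0r addr0 -mulr2n -mulr_natl mulf_neq0.
Qed.

(** With [u] proportional to [v A], the correction [u^T u] vanishes wherever [A]
    does, because [A] is symmetric; its scaling by the square root of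
    [v A v^T] puts [v] itself, which [A] does not kill, in the new kernel. *)
Lemma sym_mx_peel (F : fieldType) (n : nat) (A : 'M[F]_n) :
    (2%:R : F) != 0 -> (forall c : F, exists s, s ^+ 2 = c) ->
    A^T = A -> A != 0 ->
  exists u : 'rV_n, (\rank (A - u^T *m u)%R < \rank A)%N.
Proof.
move=> nz2 sqrtF symA nzA.
have [v nz_c] := sym_mx_anisotropic_vector F n A nz2 symA nzA.
set c := (_ *m _) 0 0 in nz_c; have [s s2] := sqrtF c.
have nz_s : s != 0 by apply: contraNneq nz_c => s0; rewrite -s2 s0 expr0n.
pose u := s^-1 *: (v *m A); exists u.
have uT : u^T = s^-1 *: (A *m v^T) by rewrite linearZ /= trmx_mul symA.
have vuT : v *m u^T = s%:M.
  rewrite uT -scalemxAr mulmxA [v *m A *m _]mx11_scalar -/c -s2.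
  by rewrite scale_scalar_mx expr2 mulKf.
have kerAv : (kermx A < kermx (A - u^T *m u))%MS.
  rewrite ltmxE; apply/andP; split.
    apply/sub_kermxP; rewrite mulmxBr mulmx_ker mulmxA.
    rewrite uT -(scalemxAr _ (kermx A)) mulmxA mulmx_ker mul0mx scaler0.
    by rewrite mul0mx subr0.
  have kv : (v <= kermx (A - u^T *m u))%MS.
    apply/sub_kermxP; rewrite mulmxBr mulmxA vuT mul_scalar_mx scalerA.
    by rewrite divff // scale1r subrr.
  apply: contra nz_c => /(submx_trans kv)/sub_kermxP vA0.
  by rewrite /c vA0 mul0mx mxE.
have := rank_ltmx kerAv; rewrite !mxrank_ker => lt_rank.
by rewrite ltnNge; apply: contraL lt_rank => le_rank; rewrite -leqNgt leq_sub2l.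
Qed.

(** Leaving the number [k] of columns of [B] free, instead of fixing it to [n],
    is what makes the induction go through: each square peeled off contributes
    one column. *)
Lemma sym_mx_factor (F : fieldType) (n k : nat) (A : 'M[F]_n) :
    (2%:R : F) != 0 -> (forall c : F, exists s, s ^+ 2 = c) ->
    A^T = A -> (\rank A <= k)%N ->
  exists B : 'M_(n, k), A = B *m B^T.
Proof.
move=> nz2 sqrtF; elim: k A => [|k IHk] A symA rankA.
  by exists 0; rewrite mul0mx; apply/eqP; rewrite -mxrank_eq0 -leqn0.
have [->|nzA] := eqVneq A 0; first by exists 0; rewrite mul0mx.
have [u lt_rank] := sym_mx_peel F n A nz2 sqrtF symA nzA.
have [||B defB] := IHk (A - u^T *m u).
- by rewrite linearB /= trmx_mul trmxK symA.
- by rewrite -ltnS (leq_trans lt_rank).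
have defA : A = row_mx u^T B *m (row_mx u^T B)^T.
  by rewrite tr_row_mx mul_row_col trmxK -defB addrC subrK.
by exists (row_mx u^T B).
Qed.

Theorem proposition1 (R : realType) (V : vectType (complex R))
    (e : (\dim {:V}).-tuple V) (e_basis : basis_of {:V} e) (Q : 'End(V)) :
  trEnd e Q = Q -> exists P : 'End(V), Q = (trEnd e P \o P)%VF.
Proof.
move=> symQ; set M := passmx.mxof e e Q.
have symM : M^T = M by rewrite {2}/M -symQ /trEnd passmx.hommxK.
have nz2 : (2%:R : complex R) != 0 by rewrite Num.Theory.pnatr_eq0.
have sqrtC (c : complex R) : exists s, s ^+ 2 = c.
  by exists (sqrtc c); apply: sqr_sqrtc.
have [B defM] := sym_mx_factor _ _ _ M nz2 sqrtC symM (rank_leq_row M).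
exists (passmx.hommx e e B); rewrite /trEnd passmx.hommxK //.
(* Matrices act on row vectors, so composition reverses the product: the
   factor of [P], which is applied first, stands on the left in [B *m B^T]. *)
by rewrite -passmx.hommx_mul // -defM passmx.mxofK.
Qed.
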